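(* Let $\ell$ be a prime power and fix an integer $r \geq 0$. For large enough $n$ and for large enough even $c$, let $C$ be a fixed alternating form on $\mathbb{F}_\ell^n$ of rank $c$, and let $M$ be a uniformly random $C$-symmetric $n\times n$ matrix over $\mathbb{F}_\ell$. Then \[ |\mathbb{P}[\dim \ker M = r] - \mu_{CL,\ell}(r)| = O_{\ell, r}(n\ell^{-c}), \] where \[ \mu_{CL,\ell}(r) = \frac{1}{|\mathrm{GL}_r(\mathbb{F}_\ell)|}\prod_{i=r+1}^\infty (1-\ell^{-i}). \]
   Context: An alternating form $C$ on $\mathbb{F}_\ell^n$ is identified with its matrix, a skew-symmetric $n\times n$ matrix over $\mathbb{F}_\ell$ with zeros on the diagonal. An $n\times n$ matrix $M$ over $\mathbb{F}_\ell$ is called $C$-symmetric if $M-M^\intercal=C$. The notation $O_{\ell,r}$ means that the implied constant (and the thresholds for ''large enough'') depend only on $\ell$ and $r$; in particular the bound is uniform in $n$, $c$ and $C$. *)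

(* Defs.v *)
From HB Require Import structures.
From mathcomp Require Import all_boot all_order all_algebra all_fingroup.
From mathcomp Require Import reals topology normedtype sequences.
Set Implicit Arguments.
Unset Strict Implicit.
Unset Printing Implicit Defensive.
Import Order.TTheory GRing.Theory Num.Theory.
Import numFieldNormedType.Exports.
Local Open Scope ring_scope.

Definition prime_power (l : nat) : Prop :=
  exists p k : nat, [/\ prime p, (0 < k)%N & l = (p ^ k)%N].

Definition alternating_mx (F : fieldType) (n : nat) (C : 'M[F]_n) : Prop :=
  C^T = - C /\ forall i, C i i = 0.

Definition C_symmetric (F : fieldType) (n : nat) (C M : 'M[F]_n) : bool :=
  M - M^T == C.

(* [kermx] is the left (row) kernel, so the transpose yields the kernel
   {v | M v = 0} of M acting on column vectors. *)
Definition dim_ker (F : fieldType) (n : nat) (M : 'M[F]_n) : nat :=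
  \rank (kermx M^T).

Definition uniform_prob (R : realType) (T : finType) (A E : {set T}) : R :=
  #|A :&: E|%:R / #|A|%:R.

Definition C_symmetric_set (F : finFieldType) (n : nat) (C : 'M[F]_n) :
    {set 'M[F]_n} :=
  [set M : 'M[F]_n | C_symmetric C M]%SET.

(* The order of GL_r is the number of invertible r x r matrices: the notation
   ['GL_r[F]] stands for GL_1 when r = 0. *)
Definition card_GL (F : finFieldType) (r : nat) : nat :=
  #|[set A : 'M[F]_r | A \in unitmx]%SET|.

Definition mu_CL (R : realType) (F : finFieldType) (r : nat) : R :=
  (card_GL F r)%:R^-1 *
  limn (fun N : nat => \prod_(r.+1 <= i < N) (1 - (#|F|%:R : R) ^- i)).

(* Main.v *)
Require Import Defs.
From HB Require Import structures.
From mathcomp Require Import all_boot all_order all_algebra all_fingroup.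
From mathcomp Require Import mxabelem ring lra zify.
From mathcomp Require Import reals topology normedtype sequences.
Import Order.TTheory GRing.Theory Num.Theory.
Import numFieldNormedType.Exports.
Set Implicit Arguments.
Unset Strict Implicit.
Unset Printing Implicit Defensive.
Local Open Scope ring_scope.

(* Write q = #|F| and count frames: for k row vectors, the number of linearly
   independent k-tuples in a d-dimensional kernel is (q^d - 1)...(q^d - q^(k-1)).
   The expectation [moment] of this number over the C-symmetric matrices is
   N_k q^(k(k-1)/2 - kn), where N_k counts the independent C-isotropic k-tuples.
   Extending a tuple X by one vector gives N_(k+1) = sum_X (q^(n - rank(X C)) - q^k),
   and rank(X C) < k only if a nonzero combination of the rows of X lies in the
   radical of C, which is rare; so all moments are 1 up to q^(k(k+1)/2 - rank C).
   The indicator of d = r is an alternating combination of the frame counts with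
   coefficients of size about q^(-k(k+1)/2), so each of the at most n + 1 terms
   contributes an error O(q^(-rank C)), and the sum in which every moment is
   replaced by 1 is a truncation of Euler's series for prod_(i > r) (1 - q^(-i)). *)

(** * Counting frames in a kernel *)

Lemma card_subspace (F : finFieldType) (m n : nat) (A : 'M[F]_(m, n)) :
  #|[set v : 'rV[F]_n | (v <= A)%MS]%SET| = (#|F| ^ \rank A)%N.
Proof. by rewrite -card_rowg; apply: eq_card => v; rewrite [RHS]mem_rowg inE. Qed.

Lemma card_left_kernel (F : finFieldType) (m n : nat) (A : 'M[F]_(m, n)) :
  #|[set v : 'rV[F]_m | v *m A == 0]%SET| = (#|F| ^ (m - \rank A))%N.
Proof.
rewrite -mxrank_ker -card_subspace; apply: eq_card => v.
by rewrite !inE sub_kermx.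
Qed.

Lemma card_col_mx (F : finFieldType) (j k n : nat)
    (P : pred 'M[F]_(j + k, n)) :
  #|[set Y | P Y]%SET| =
  (\sum_(X : 'M[F]_(k, n)) #|[set V : 'M[F]_(j, n) | P (col_mx V X)]%SET|)%N.
Proof.
under eq_bigr do rewrite -sum1dep_card.
rewrite -sum1dep_card pair_big_dep /=.
rewrite (reindex (fun p : 'M[F]_(k, n) * 'M[F]_(j, n) => col_mx p.2 p.1)) //=.
exists (fun Y => (dsubmx Y, usubmx Y)) => [[X V] _|Y _] /=.
  by rewrite col_mxKd col_mxKu.
exact: vsubmxK.
Qed.

Lemma row_free_col_mx_rV (F : fieldType) (k n : nat) (v : 'rV[F]_n)
    (X : 'M[F]_(k, n)) :
  row_free (col_mx v X) = row_free X && ~~ (v <= X)%MS.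
Proof.
have [vX|vX] /= := boolP (v <= X)%MS.
  rewrite andbF; apply/negbTE; rewrite -row_leq_rank -ltnNge -addsmxE.
  rewrite ltnS (leq_trans _ (rank_leq_row X)) //; apply: mxrankS.
  by rewrite addsmx_sub vX submx_refl.
have v0 : v != 0 by apply: contraNneq vX => ->; exact: sub0mx.
rewrite andbT -!row_leq_rank -addsmxE.
have : mxdirect (v + X).
  apply/mxdirect_addsP/eqP; rewrite -submx0; apply/rV_subP => u.
  rewrite sub_capmx => /andP[/sub_rVP[a ->] avX].
  have [->|a0] := eqVneq a 0; first by rewrite scale0r sub0mx.
  by move: avX; rewrite (eqmx_scale _ a0) (negbTE vX).
by rewrite mxdirectE /= => /eqP ->; rewrite rank_rV v0.
Qed.

(** Frames are made of rows because [kermx] is the left kernel; [dim_kerE] shows that the dimension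
    is the same on either side. *)
Definition free_rows_in_ker (F : finFieldType) (k n : nat) (M : 'M[F]_n) :=
  [set X : 'M[F]_(k, n) | row_free X && (X *m M == 0)]%SET.

(** A new row is any kernel vector outside the span of the previous rows. Truncated subtraction is
    harmless: when [k] exceeds the kernel dimension d, the factor at i = d is 0. *)
Lemma card_free_rows_in_ker (F : finFieldType) (k n : nat) (M : 'M[F]_n) :
  #|free_rows_in_ker k M| =
  (\prod_(i < k) (#|F| ^ \rank (kermx M) - #|F| ^ i))%N.
Proof.
elim: k => [|k IHk].
  rewrite big_ord0; apply/eqP/cards1P; exists 0; apply/setP => X.
  rewrite !inE [X]flatmx0 eqxx -row_leq_rank /=.
  by rewrite [0 *m _]flatmx0 eqxx.
rewrite big_ord_recr /= -IHk /free_rows_in_ker.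
rewrite -[in LHS]add1n card_col_mx -sum_nat_const.
rewrite [RHS]big_mkcond; apply: eq_bigr => X _; rewrite inE.
have [/andP[fX /eqP XM]|XM] := boolP (row_free X && _); last first.
  apply/eqP; rewrite cards_eq0; apply/eqP/setP => v; rewrite !inE.
  apply/negbTE; apply: contra XM.
  rewrite row_free_col_mx_rV mul_col_mx col_mx_eq0.
  by case/andP=> /andP[-> _] /andP[_ ->].
move/eqP: (fX) => rX.
rewrite -[in Z in (_ - Z)%N]rX -!card_subspace.
rewrite (_ : [set _ | _]%SET = [set v : 'rV_n | v <= kermx M]%MS%SET
   :\: [set v : 'rV_n | v <= X]%MS%SET); last first.
  apply/setP => v; rewrite !inE row_free_col_mx_rV mul_col_mx col_mx_eq0.
  by rewrite fX XM eqxx andbT sub_kermx.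
rewrite cardsD (setIidPr _) //; apply/subsetP => v; rewrite !inE.
by move/submx_trans; apply; apply/sub_kermxP.
Qed.

(** An invertible matrix is a full frame in the kernel of the zero matrix. *)
Lemma card_GL_prod (F : finFieldType) (r : nat) :
  Defs.card_GL F r = (\prod_(i < r) (#|F| ^ r - #|F| ^ i))%N.
Proof.
have := card_free_rows_in_ker r (0 : 'M[F]_r).
rewrite mxrank_ker mxrank0 subn0 => <-; apply: eq_card => X.
by rewrite !inE row_free_unit mulmx0 eqxx andbT.
Qed.

(** * Counting C-symmetric matrices *)

Section CSymmetric.
Variable F : finFieldType.

(** The upper right block of M and that of C determine the lower left block of M, so only the lower
    right block stays free, under its own symmetry condition. *)
Lemma card_C_symmetric_top (k m : nat) (C : 'M[F]_(k + m)) (T : 'M[F]_(k, k + m)) :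
  C^T = - C ->
  #|[set M in C_symmetric_set C | usubmx M == T]%SET| =
  ((lsubmx T \in C_symmetric_set (ulsubmx C))
   * #|C_symmetric_set (drsubmx C)|)%N.
Proof.
rewrite -[C]submxK; set C1 := ulsubmx C; set C2 := ursubmx C.
set C3 := dlsubmx C; set C4 := drsubmx C.
rewrite tr_block_mx opp_block_mx => /eq_block_mx[_ _ C23 _].
rewrite block_mxKul block_mxKdr.
pose f N : 'M[F]_(k + m) :=
  block_mx (lsubmx T) (rsubmx T) (rsubmx T - C2)^T N.
have fsym N : (f N \in C_symmetric_set (block_mx C1 C2 C3 C4)) =
    (lsubmx T \in C_symmetric_set C1) && (N \in C_symmetric_set C4).
  rewrite !inE /C_symmetric /f tr_block_mx opp_block_mx add_block_mx trmxK.
  apply/eqP/andP => [/eq_block_mx[-> _ _ ->] //|[/eqP -> /eqP ->]].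
  congr block_mx; first by rewrite opprB addrC subrK.
  by rewrite linearB /= C23 opprK addrAC subrr add0r.
transitivity (\sum_(M in C_symmetric_set (block_mx C1 C2 C3 C4) | usubmx M == T) 1)%N.
  by rewrite sum1dep_card.
rewrite (reindex_onto f drsubmx) /=; last first.
  move=> M /andP[]; rewrite inE -[M]submxK.
  set M1 := ulsubmx M; set M2 := ursubmx M.
  set M3 := dlsubmx M; set M4 := drsubmx M.
  rewrite /C_symmetric tr_block_mx opp_block_mx add_block_mx.
  move=> /eqP/eq_block_mx[_ M2E _ _]; rewrite /block_mx col_mxKu => /eqP TE.
  rewrite /f -TE -/(block_mx _ _ _ _) block_mxKdr row_mxKl row_mxKr -M2E.
  by rewrite opprB addrC subrK trmxK.
under eq_bigl => N.
  rewrite fsym /f block_mxKdr eqxx andbT /block_mx col_mxKu hsubmxK eqxx andbT.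
  over.
case: (lsubmx T \in _) => /=; last by rewrite big_pred0_eq.
by rewrite mul1n sum1_card.
Qed.

(** T is the strict upper triangle of C. The shape T - T^T survives congruence, which keeps the
    diagonal zero in characteristic 2 as well. *)
Lemma alternating_mx_exists_C_symmetric (n : nat) (C : 'M[F]_n) :
  alternating_mx C -> exists T : 'M[F]_n, C = T - T^T.
Proof.
move=> [Ct C0]; exists (\matrix_(i, j) if (i < j)%N then C i j else 0).
apply/matrixP => i j; rewrite !mxE.
have Cji : C j i = - C i j by move/matrixP: Ct => /(_ i j); rewrite !mxE.
by case: ltngtP => [ij|ji|/val_inj ->]; rewrite ?Cji ?subr0 ?sub0r ?opprK.
Qed.

Lemma alternating_mx_sub_tr (n : nat) (T : 'M[F]_n) : alternating_mx (T - T^T).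
Proof.
by split=> [|i]; [rewrite linearB /= trmxK opprB | rewrite !mxE subrr].
Qed.

Lemma alternating_mx_congr (n m : nat) (C : 'M[F]_n) (U : 'M[F]_(m, n)) :
  alternating_mx C -> alternating_mx (U *m C *m U^T).
Proof.
move=> /alternating_mx_exists_C_symmetric[T ->].
have -> : U *m (T - T^T) *m U^T = U *m T *m U^T - (U *m T *m U^T)^T.
  by rewrite !trmx_mul trmxK mulmxBr mulmxBl mulmxA.
exact: alternating_mx_sub_tr.
Qed.

Lemma alternating_drsubmx (k m : nat) (C : 'M[F]_(k + m)) :
  alternating_mx C -> alternating_mx (drsubmx C).
Proof.
move=> [Ct C0]; split=> [|i]; last by rewrite !mxE C0.
by rewrite trmx_drsub Ct; apply/matrixP => i j; rewrite !mxE.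
Qed.

(** The induction peels off the first row, which is arbitrary: its corner entry only has to satisfy
    0 = 0, as C has zero diagonal. *)
Lemma card_C_symmetric_set (n : nat) (C : 'M[F]_n) :
  alternating_mx C -> #|C_symmetric_set C| = (#|F| ^ 'C(n.+1, 2))%N.
Proof.
elim: n C => [|n IHn] C altC.
  rewrite bin_small // expn0; apply/eqP/cards1P; exists 0; apply/setP => M.
  by rewrite !inE /C_symmetric [M]flatmx0 [C]flatmx0 [X in X == _]flatmx0 !eqxx.
move: C altC; rewrite -[n.+1]add1n => C altC.
rewrite -sum1_card (partition_big (@usubmx F 1 n _) predT) //=.
under eq_bigr => T _.
  rewrite sum1dep_card (@card_C_symmetric_top 1 n C T); last by case: altC.
  rewrite (IHn _ (alternating_drsubmx _)) // inE /C_symmetric.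
  rewrite (_ : _ == _); last first.
    apply/eqP/matrixP => i j; rewrite !ord1 !mxE subrr.
    by case: altC => _ ->.
  rewrite mul1n; over.
rewrite sum_nat_const card_mx mul1n -expnD; congr (_ ^ _)%N.
by rewrite add1n [RHS]binS bin1 addnC.
Qed.

Lemma row_free_completion (k m : nat) (X : 'M[F]_(k, k + m)) :
  row_free X -> exists2 U : 'M[F]_(k + m), U \in unitmx & usubmx U = X.
Proof.
move=> /eqP rX; exists (block_mx (col_ebase X) 0 0 1%:M *m row_ebase X).
  rewrite unitmx_mul row_ebase_unit andbT unitmxE det_ublock det1 mulr1 -unitmxE.
  exact: col_ebase_unit.
rewrite -[in RHS](mulmx_ebase X) rX pid_mx_row -mulmxA.
by rewrite block_mxEv mul_col_mx col_mxKu -{2}[row_ebase X]vsubmxK !mul_row_col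
  mul1mx !mul0mx addr0 -{1}[row_ebase X]vsubmxK mul_row_col mul0mx addr0.
Qed.

(** Complete X to an invertible U. Then M -> U M U^T turns C-symmetry into D-symmetry with D = U C
    U^T, and X M = 0 into the vanishing of the top k rows. *)
Lemma card_C_symmetric_annihilated (n k : nat) (C : 'M[F]_n) (X : 'M[F]_(k, n)) :
  alternating_mx C -> row_free X ->
  #|[set M in C_symmetric_set C | X *m M == 0]%SET| =
  ((X *m C *m X^T == 0%R) * #|F| ^ 'C((n - k).+1, 2))%N.
Proof.
move=> altC fX.
have kn : (k <= n)%N by rewrite -(eqP fX) rank_leq_col.
rewrite -(subnKC kn) in C X altC fX *; move: (n - k)%N => m in C X altC fX *.
rewrite addKn {n kn}.
have [U uU UX] := row_free_completion fX.
have uUt : U^T \in unitmx by rewrite unitmx_tr.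
pose D := U *m C *m U^T.
have altD : alternating_mx D by exact: alternating_mx_congr.
rewrite -(card_C_symmetric_set (alternating_drsubmx altD)).
have -> : (X *m C *m X^T == 0) =
    (lsubmx (0 : 'M_(k, k + m)) \in C_symmetric_set (ulsubmx D)).
  rewrite inE /C_symmetric linear0 trmx0 subr0 eq_sym; congr (_ == _).
  rewrite -UX /D -[in RHS](vsubmxK U) tr_col_mx mul_col_mx mul_col_mx.
  by rewrite /ulsubmx col_mxKu mul_mx_row row_mxKl.
rewrite -card_C_symmetric_top; last by case: altD.
rewrite -!sum1dep_card.
rewrite [RHS](reindex_onto (fun M => U *m M *m U^T)
  (fun N => invmx U *m N *m invmx U^T)) /=; last first.
  by move=> N _; rewrite -!mulmxA mulVmx // mulmx1 mulmxA mulmxV // mul1mx.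
apply: eq_bigl => M.
rewrite !inE /C_symmetric.
have -> : invmx U *m (U *m M *m U^T) *m invmx U^T = M.
  by rewrite !mulmxA mulVmx // mul1mx mulmxK.
rewrite eqxx andbT trmx_mul trmx_mul trmxK mulmxA -mulmxBl -mulmxA -mulmxBr; congr (_ && _).
  rewrite /D; apply/eqP/eqP => [->//|].
  by rewrite -!mulmxA => /(can_inj (mulKmx uU)) /(can_inj (mulmxK uUt)).
rewrite -!mul_usub_mx UX ?mulmxA.
by apply/eqP/eqP => [->|/(congr1 (mulmx^~ (invmx U^T)))]; rewrite ?mul0mx ?mulmxK.
Qed.

End CSymmetric.

(** * Isotropic frames and moments *)

Section IsotropicFrames.
Variables (F : finFieldType) (n : nat) (C : 'M[F]_n).
Hypothesis altC : alternating_mx C.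
Local Notation q := #|F|.

(** Only these frames can lie in a kernel: if X M = 0 with M - M^T = C, then X C X^T = X M X^T - X
    (X M)^T = 0. *)
Definition isotropic_frames (k : nat) : {set 'M[F]_(k, n)} :=
  [set X : 'M[F]_(k, n) | row_free X && (X *m C *m X^T == 0)]%SET.

Lemma card_isotropic_frames0 : #|isotropic_frames 0| = 1%N.
Proof.
apply/eqP/cards1P; exists 0; apply/setP => X.
rewrite !inE [X]flatmx0 eqxx -row_leq_rank /=.
by rewrite [_ *m _ *m _]flatmx0 eqxx.
Qed.

(** The corner v C v^T vanishes, and the two off-diagonal blocks are opposite transposes, so they
    give a single condition. *)
Lemma isotropic_col_mx_rV (k : nat) (v : 'rV[F]_n) (X : 'M[F]_(k, n)) :
  (col_mx v X *m C *m (col_mx v X)^T == 0) =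
  (X *m C *m X^T == 0) && (v *m (C *m X^T) == 0).
Proof.
rewrite tr_col_mx !mul_col_mx !mul_mx_row -/(block_mx _ _ _ _) block_mx_eq0.
have -> : v *m C *m v^T = 0.
  apply/matrixP => i j; rewrite !ord1 [RHS]mxE.
  by case: (alternating_mx_congr v altC).
have -> : X *m C *m v^T = - (v *m (C *m X^T))^T.
  by case: altC => Ct _; rewrite !trmx_mul trmxK Ct mulmxN mulNmx opprK.
rewrite oppr_eq0 trmx_eq0 mulmxA eqxx /=.
by rewrite andbA andbb andbC.
Qed.

(** The new vector ranges over the C-orthogonal of X minus the span of X; isotropy places the span
    inside the orthogonal. *)
Lemma card_isotropic_frames_step (k : nat) :
  #|isotropic_frames k.+1| =
  (\sum_(X in isotropic_frames k) (q ^ (n - \rank (X *m C)) - q ^ k))%N.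
Proof.
rewrite {1}/isotropic_frames -[in LHS]add1n card_col_mx [RHS]big_mkcond.
apply: eq_bigr => X _; rewrite inE.
have [/andP[fX /eqP XC]|XC] := boolP (row_free X && _); last first.
  apply/eqP; rewrite cards_eq0; apply/eqP/setP => v; rewrite !inE.
  apply/negbTE; apply: contra XC.
  rewrite row_free_col_mx_rV isotropic_col_mx_rV.
  by case/andP=> /andP[-> _] /andP[-> _].
have -> : \rank (X *m C) = \rank (C *m X^T).
  case: altC => Ct _.
  by rewrite -mxrank_tr trmx_mul Ct mulNmx mxrank_opp.
move/eqP: (fX) => rX.
rewrite -[in Z in (_ - Z)%N]rX -card_subspace -card_left_kernel.
rewrite (_ : [set _ | _]%SET = [set v : 'rV_n | v *m (C *m X^T) == 0]%SET
   :\: [set v : 'rV_n | v <= X]%MS%SET); last first.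
  apply/setP => v; rewrite !inE row_free_col_mx_rV isotropic_col_mx_rV.
  by rewrite fX XC eqxx.
rewrite cardsD (setIidPr _) //; apply/subsetP => v; rewrite !inE.
by move=> /submxP[D ->]; rewrite -mulmxA [X *m _]mulmxA XC mulmx0.
Qed.

(* If [a i != 0] then [X] is recovered from [a *m X] and its rows other than [i]. *)
Lemma card_mx_comb_in_ker (k : nat) (a : 'rV[F]_k.+1) :
  a != 0 ->
  (#|[set X : 'M[F]_(k.+1, n) | a *m X *m C == 0%R]%SET|
    <= q ^ (n - \rank C) * q ^ (k * n))%N.
Proof.
move=> /rV0Pn[i ai].
rewrite -card_left_kernel -card_mx -[#|{: _}|]cardsT -cardsX.
pose f (X : 'M[F]_(k.+1, n)) := (a *m X, row' i X).
have finj : injective f.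
  move=> X Y [aXY /matrixP XY'].
  have XY j : j != i -> row j X = row j Y.
    rewrite eq_sym => /unlift_some[j' -> _].
    by apply/rowP => s; move: (XY' j' s); rewrite !mxE.
  apply/row_matrixP => j; have [->|/XY//] := eqVneq j i.
  rewrite !mulmx_sum_row in aXY.
  rewrite (bigD1 i) //= [RHS](bigD1 i) //= in aXY.
  have E : \sum_(j < k.+1 | j != i) a 0 j *: row j X =
           \sum_(j < k.+1 | j != i) a 0 j *: row j Y.
    by apply: eq_bigr => s /XY ->.
  by move: aXY; rewrite E => /addIr /(scalerI ai).
rewrite -(card_imset _ finj); apply: subset_leq_card.
by apply/subsetP => _ /imsetP[X XC ->]; rewrite !inE andbT in XC *.
Qed.

(** The power q^(k - rank(X C)) counts the row vectors a with a X C = 0. After exchanging sums, a =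
    0 contributes the number of frames and every other a is bounded by [card_mx_comb_in_ker]. *)
Lemma sum_comb_in_ker_le (k : nat) :
  (q ^ \rank C * \sum_(X in isotropic_frames k) q ^ (k - \rank (X *m C))
   <= q ^ \rank C * #|isotropic_frames k| + q ^ (k + k * n))%N.
Proof.
case: k => [|k].
  apply: leq_trans (leq_addr _ _); rewrite leq_mul2l -sum1_card.
  by apply/orP; right; apply: leq_sum.
have -> : (q ^ (k.+1 + k.+1 * n) =
    q ^ \rank C * (q ^ k.+1 * (q ^ (n - \rank C) * q ^ (k * n))))%N.
  rewrite -!expnD; congr (_ ^ _)%N.
  by rewrite mulSn -{1}(subnKC (rank_leq_col C)) -!addnA addnCA.
rewrite -mulnDr leq_mul2l; apply/orP; right.
under eq_bigr do rewrite -card_left_kernel -sum1dep_card.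
rewrite (exchange_big_dep predT) //= (bigD1 0) //=; apply: leq_add.
  rewrite -sum1_card; apply: eq_leq; apply: eq_bigl => X.
  by rewrite mul0mx eqxx andbT.
have <- : #|{: 'rV[F]_k.+1}| = (q ^ k.+1)%N by rewrite card_mx mul1n.
rewrite -sum1_card big_distrl /= big_mkcond; apply: leq_sum => a _.
case: ifP => // a0; rewrite mul1n; apply: leq_trans (card_mx_comb_in_ker a0).
rewrite sum1dep_card; apply: subset_leq_card; apply/subsetP => X.
by rewrite !inE mulmxA => /andP[].
Qed.

Lemma card_isotropic_frames_le (k : nat) :
  (#|isotropic_frames k| <= q ^ (k * n))%N.
Proof. by rewrite -card_mx max_card. Qed.

(** Drop the subtracted q^k and split n - rank(X C) as (n - k) + (k - rank(X C)). *)
Lemma card_isotropic_framesS_le (k : nat) : (k <= n)%N ->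
  (q ^ \rank C * #|isotropic_frames k.+1| <=
   q ^ (n - k) * (q ^ \rank C * #|isotropic_frames k| + q ^ (k + k * n)))%N.
Proof.
move=> kn; apply: leq_trans (leq_mul (leqnn _) (sum_comb_in_ker_le k)).
rewrite mulnCA leq_mul2l; apply/orP; right.
rewrite card_isotropic_frames_step big_distrr /=; apply: leq_sum => X _.
rewrite (leq_trans (leq_subr _ _)) // -expnD addnBA ?rank_leq_row //.
by rewrite subnK.
Qed.

Lemma card_isotropic_framesS_ge (k : nat) :
  (q ^ (n - k) * #|isotropic_frames k|
   <= #|isotropic_frames k.+1| + q ^ k * #|isotropic_frames k|)%N.
Proof.
rewrite card_isotropic_frames_step -sum1_card !big_distrr /= -big_split /=.
apply: leq_sum => X _; rewrite !muln1 addnC -leq_subLR leq_sub2r //.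
apply: leq_pexp2l; first exact: ltnW (card_finNzRing_gt1 F).
by apply: leq_sub2l; exact: rank_leq_row.
Qed.

Lemma sum_card_free_rows_in_ker (k : nat) :
  (\sum_(M in C_symmetric_set C) #|free_rows_in_ker k M| =
   #|isotropic_frames k| * q ^ 'C((n - k).+1, 2))%N.
Proof.
under eq_bigr do rewrite -sum1dep_card.
rewrite (exchange_big_dep (@row_free F k n)) /=; last by move=> M X _ /andP[].
rewrite -sum_nat_const [RHS]big_mkcond /= big_mkcond; apply: eq_bigr => X _.
rewrite inE; case: ifP => //= fX.
under eq_bigl => M do rewrite fX /=.
rewrite sum1dep_card card_C_symmetric_annihilated //.
by case: eqP; rewrite ?mul1n ?mul0n.
Qed.

(** With m = n - k, this is the exponent identity that normalizes [moment] in [momentE]. *)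
Lemma bin2_complement (k m : nat) :
  ('C(m.+1, 2) + k * (k + m) = 'C((k + m).+1, 2) + 'C(k, 2))%N.
Proof.
elim: k => [|k IHk]; first by rewrite mul0n bin0n addn0.
have bin2S j : 'C(j.+1, 2) = ('C(j, 2) + j)%N by rewrite binS bin1.
by rewrite addSn (bin2S (k + m).+1) (bin2S k); lia.
Qed.

Section Moments.
Variable R : realType.
Local Notation Q := (q%:R : R).

(** By [momentE], this closed form is the mean number of k-frames in the kernel when k <= n. *)
Definition moment (k : nat) : R :=
  #|isotropic_frames k|%:R * Q ^+ 'C(k, 2) / Q ^+ (k * n).

Lemma card_field_ge2 : 2 <= Q.
Proof. by rewrite ler_nat card_finNzRing_gt1. Qed.

Lemma card_field_gt0 : 0 < Q.
Proof. exact: lt_le_trans card_field_ge2. Qed.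

Lemma momentE (k : nat) : (k <= n)%N ->
  moment k = (\sum_(M in C_symmetric_set C) #|free_rows_in_ker k M|)%:R
             / #|C_symmetric_set C|%:R.
Proof.
move=> kn; rewrite sum_card_free_rows_in_ker card_C_symmetric_set //.
rewrite natrM !natrX /moment -!mulrA; congr (_ * _).
have Q0 : Q != 0 by rewrite gt_eqF // card_field_gt0.
apply/eqP; rewrite eqr_div ?expf_neq0 //.
rewrite -!exprD; apply/eqP; congr (_ ^+ _).
by have := bin2_complement k (n - k); rewrite subnKC // => ->; rewrite addnC.
Qed.

(** Let e be the bound for k. One step gives m' <= m + e and m <= m' + e Q^k, so the error becomes
    at most e + e Q^k <= 2 e Q^k <= e Q^(k+1), the bound for k + 1. *)
Lemma moment_close (k : nat) : (k <= n)%N ->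
  `|moment k - 1| <= Q ^+ 'C(k.+1, 2) / Q ^+ \rank C.
Proof.
have Q2 := card_field_ge2; have Q0 := card_field_gt0.
have Q1 : 1 <= Q by apply: le_trans Q2; rewrite ler1n.
have QX j : 0 < Q ^+ j by exact: exprn_gt0.
elim: k => [|k IHk] kn.
  rewrite /moment card_isotropic_frames0 mul0n bin0n expr0 divr1 mulr1 subrr.
  by rewrite normr0 divr_ge0 // ltW.
have {}IHk := IHk (ltnW kn).
have up := card_isotropic_framesS_le (ltnW kn).
have lo := card_isotropic_framesS_ge k.
have tr := card_isotropic_frames_le k.
rewrite -(ler_nat R) in up; rewrite -(ler_nat R) in lo; rewrite -(ler_nat R) in tr.
rewrite !(natrM, natrD, natrX) in up lo tr.
pose m := moment k; pose m' := moment k.+1.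
pose e := Q ^+ 'C(k, 2) * Q ^+ k / Q ^+ \rank C.
have kE : 'C(k.+1, 2) = ('C(k, 2) + k)%N by rewrite binS bin1.
have e0 : 0 <= e by rewrite divr_ge0 ?mulr_ge0 // ltW.
have m'E : m' = #|isotropic_frames k.+1|%:R * Q ^+ 'C(k, 2) /
                (Q ^+ (k * n) * Q ^+ (n - k)).
  have QnE : Q ^+ n = Q ^+ k * Q ^+ (n - k) by rewrite -exprD subnKC // ltnW.
  rewrite /m' /moment kE mulSn !exprD QnE.
  by field; rewrite !gt_eqF.
have m'_le : m' <= m + e.
  rewrite m'E /m /moment /e ler_pdivrMr ?mulr_gt0 //.
  rewrite -(ler_pM2l (QX (\rank C))).
  apply: le_trans (_ : Q ^+ 'C(k, 2) * (Q ^+ (n - k) *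
    (Q ^+ \rank C * #|isotropic_frames k|%:R + Q ^+ (k + k * n))) <= _).
    by rewrite [leLHS]mulrA [leLHS]mulrC ler_pM2l.
  by rewrite exprD le_eqVlt; apply/orP; left; apply/eqP; field; rewrite !gt_eqF.
have m_le : m <= Q ^+ 'C(k, 2).
  by rewrite /m /moment ler_pdivrMr // mulrC ler_pM2l.
(* The loss is Q^k / Q^(n-k) times m; it is controlled by the crude bound on m and by rank C <=
   n. *)
have m_le' : m <= m' + e * Q ^+ k.
  apply: le_trans (_ : m' + Q ^+ k / Q ^+ (n - k) * m <= _).
    rewrite m'E /m /moment.
    rewrite -(ler_pM2l (QX (n - k)%N)) -(ler_pM2l (QX (k * n)%N)).
    apply: le_trans (_ : Q ^+ 'C(k, 2) * (#|isotropic_frames k.+1|%:R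
        + Q ^+ k * #|isotropic_frames k|%:R) <= _); last first.
      by rewrite le_eqVlt; apply/orP; left; apply/eqP; field; rewrite !gt_eqF.
    apply: le_trans (_ : Q ^+ 'C(k, 2) * (Q ^+ (n - k) * #|isotropic_frames k|%:R) <= _).
      by rewrite le_eqVlt; apply/orP; left; apply/eqP; field; rewrite !gt_eqF.
    by rewrite ler_pM2l.
  rewrite lerD2l; apply: le_trans (_ : Q ^+ k / Q ^+ (n - k) * Q ^+ 'C(k, 2) <= _).
    by rewrite ler_pM2l // divr_gt0.
  have Qnk : (Q ^+ (n - k))^-1 <= Q ^+ k / Q ^+ \rank C.
    rewrite ler_pdivlMr // mulrC ler_pdivrMr // -exprD subnKC ?(ltnW kn) //.
    by rewrite ler_weXn2l // rank_leq_col.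
  have -> : Q ^+ k / Q ^+ (n - k) * Q ^+ 'C(k, 2) =
    Q ^+ 'C(k, 2) * Q ^+ k * (Q ^+ (n - k))^-1 by ring.
  have -> : e * Q ^+ k = Q ^+ 'C(k, 2) * Q ^+ k * (Q ^+ k / Q ^+ \rank C).
    by rewrite /e; ring.
  by rewrite ler_pM2l // mulr_gt0.
have b1 : 1 <= Q ^+ k by exact: exprn_ege1.
have -> : Q ^+ 'C(k.+2, 2) / Q ^+ \rank C = e * Q ^+ k * Q.
  by rewrite binS bin1 kE !exprD exprS /e; field; rewrite gt_eqF.
move: IHk; rewrite kE exprD -/e -/m -/m' !ler_norml => /andP[l1 l2].
have eb : e <= e * Q ^+ k by rewrite ler_peMr.
have ebQ : 2 * (e * Q ^+ k) <= e * Q ^+ k * Q.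
  by rewrite mulrC ler_wpM2l // mulr_ge0 // ltW.
by apply/andP; split; lra.
Qed.

End Moments.
End IsotropicFrames.

(** * Inversion of the moments and Euler's product *)

Section QSeries.
Variables (R : realType) (Q : R).
Hypothesis Q2 : 2 <= Q.

Let Q0 : 0 < Q. Proof. exact: lt_le_trans Q2. Qed.
Let Q1 : 1 <= Q. Proof. by apply: le_trans Q2; rewrite ler1n. Qed.
Let QX0 j : 0 < Q ^+ j. Proof. exact: exprn_gt0. Qed.
Let QS1_gt0 j : 0 < Q ^+ j.+1 - 1.
Proof. by rewrite subr_gt0 exprn_egt1 // (lt_le_trans _ Q2) // ltr1n. Qed.

Definition qfact (i : nat) : R := \prod_(j < i) (Q ^+ j.+1 - 1).

Lemma qfact_gt0 i : 0 < qfact i.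
Proof. by apply: prodr_gt0 => j _; exact: QS1_gt0. Qed.

Lemma qfactS i : qfact i.+1 = qfact i * (Q ^+ i.+1 - 1).
Proof. by rewrite /qfact big_ord_recr. Qed.

(** Coefficients of Euler's series: the sum of [euler_coef i * z ^+ i] over all i is the product of
    1 - z Q^(-j) over j >= 1. At z = Q^(-r) this is the product in [mu_CL]. *)
Definition euler_coef (i : nat) : R := (-1) ^+ i / qfact i.

Lemma euler_coef0 : euler_coef 0 = 1.
Proof. by rewrite /euler_coef /qfact big_ord0 expr0 divr1. Qed.

Lemma euler_coefS i : euler_coef i.+1 * (Q ^+ i.+1 - 1) = - euler_coef i.
Proof.
rewrite /euler_coef qfactS exprS; field.
by rewrite !gt_eqF ?qfact_gt0 ?QS1_gt0.
Qed.

Lemma norm_euler_coef i : `|euler_coef i| = (qfact i)^-1.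
Proof. by rewrite normrM normrX normrN1 expr1n mul1r gtr0_norm ?invr_gt0 ?qfact_gt0. Qed.

(* The extra factor [1 + 2 / Q ^+ i.+1] makes the induction go through. *)
Lemma qfact_ge_strong i :
  Q ^+ 'C(i.+2, 2) * (1 + 2 / Q ^+ i.+1) <= 4 * qfact i.+1.
Proof.
elim: i => [|i IHi].
  rewrite /qfact big_ord1 !expr1 mulrDr mulr1 mulrCA divff ?gt_eqF // mulr1.
  by move: Q2; lra.
have -> : 'C(i.+3, 2) = ('C(i.+2, 2) + i.+2)%N by rewrite [LHS]binS bin1.
rewrite qfactS exprD.
apply: le_trans (_ : Q ^+ 'C(i.+2, 2) * (1 + 2 / Q ^+ i.+1)
                     * (Q ^+ i.+2 - 1) <= _); last by rewrite mulrA ler_pM2r.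
rewrite -[leLHS]mulrA -[leRHS]mulrA ler_pM2l // [Q ^+ i.+2]exprS; set x := Q ^+ i.+1.
have x2 : 2 <= x by apply: le_trans Q2 _; rewrite -[leLHS]expr1 ler_weXn2l.
have x0 : 0 < x by exact: QX0.
have -> : Q * x * (1 + 2 / (Q * x)) = Q * x + 2 by field; rewrite !gt_eqF.
have -> : (1 + 2 / x) * (Q * x - 1) = Q * x + 2 * Q - 1 - 2 / x.
  by field; rewrite gt_eqF.
have : 2 / x <= 1 by rewrite ler_pdivrMr // mul1r.
by move: Q2; lra.
Qed.

(** The constant 4 works because the product of 1 - 2^(-j) over j >= 1 exceeds 1/4. *)
Lemma qfact_ge i : Q ^+ 'C(i.+1, 2) <= 4 * qfact i.
Proof.
case: i => [|i]; first by rewrite /qfact big_ord0 expr0 mulr1 ler1n.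
by apply: le_trans (qfact_ge_strong i); rewrite ler_peMr ?ltW // ltrDl divr_gt0.
Qed.

(** The truncated sum factors with roots Q, ..., Q^I, which makes the inversion below exact. *)
Lemma sum_euler_coef_prod (x : R) (I : nat) :
  \sum_(i < I.+1) euler_coef i * \prod_(t < i) (x - Q ^+ t) =
  euler_coef I * \prod_(j < I) (x - Q ^+ j.+1).
Proof.
elim: I => [|I IHI]; first by rewrite big_ord1 !big_ord0.
rewrite big_ord_recr /= IHI big_ord_recl big_ord_recr /=.
have /eqP := euler_coefS I; rewrite -eqr_oppLR => /eqP <-.
by rewrite /bump /= expr0; ring.
Qed.

(** For d < r every product has a zero factor. For d >= r, powers of Q^r come out and the rest is
    [sum_euler_coef_prod] at x = Q^(d-r): it is 1 at x = 1 and 0 at its roots. *)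
Lemma q_moment_inversion (d r n : nat) : (d <= n)%N -> (r <= n)%N ->
  \sum_(i < (n - r).+1)
     euler_coef i / Q ^+ (r * i) * \prod_(t < r + i) (Q ^+ d - Q ^+ t)
  = (d == r)%:R * \prod_(t < r) (Q ^+ r - Q ^+ t).
Proof.
move=> dn rn; have [dr|rd] := ltnP d r.
  rewrite ltn_eqF // mul0r big1 // => i _.
  have dri : (d < r + i)%N by rewrite ltn_addr.
  by rewrite (bigD1 (Ordinal dri)) //= subrr mul0r mulr0.
transitivity (\prod_(t < r) (Q ^+ d - Q ^+ t) *
  \sum_(i < (n - r).+1) euler_coef i * \prod_(t < i) (Q ^+ (d - r) - Q ^+ t)).
  rewrite big_distrr; apply: eq_bigr => i _ /=.
  have -> : \prod_(t < r + i) (Q ^+ d - Q ^+ t) = \prod_(t < r) (Q ^+ d - Q ^+ t)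
     * (Q ^+ (r * i) * \prod_(t < i) (Q ^+ (d - r) - Q ^+ t)).
    rewrite big_split_ord /=; congr (_ * _).
    have -> : Q ^+ (r * i) = \prod_(t < i) Q ^+ r.
      by rewrite prodr_const card_ord exprM.
    rewrite -big_split /=.
    apply: eq_bigr => t _; rewrite exprD -{1}(subnKC rd) exprD.
    by rewrite mulrBr.
  by field; rewrite gt_eqF.
rewrite sum_euler_coef_prod.
have [->|ndr] := eqVneq d r.
  rewrite mul1r subnn expr0; have := sum_euler_coef_prod 1 (n - r).
  rewrite big_ord_recl big_ord0 mulr1 euler_coef0 big1 => [|i _].
    by rewrite addr0 => <-; rewrite mulr1.
  by rewrite big_ord_recl expr0 subrr mul0r mulr0.
(* Factor j carries Q^(j+1), so the root Q^(d-r) sits at index d - r - 1. *)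
have lt : ((d - r).-1 < n - r)%N by lia.
rewrite mul0r [X in _ * (_ * X)](bigD1 (Ordinal lt)) //= prednK ?subrr; last by lia.
by rewrite mul0r !mulr0.
Qed.

(** * Truncated Euler series against the infinite product *)

Definition euler_sum (N : nat) (z : R) : R := \sum_(i < N.+1) euler_coef i * z ^+ i.

(** The functional equation f(z) = (1 - z/Q) f(z/Q) of Euler's series, plus the boundary term due to
    truncation. *)
Lemma euler_sum_shift N z :
  euler_sum N z = (1 - z / Q) * euler_sum N (z / Q) + euler_coef N * (z / Q) ^+ N.+1.
Proof.
elim: N => [|N IHN].
  by rewrite /euler_sum !big_ord1 euler_coef0 !expr0 expr1; ring.
rewrite /euler_sum [in LHS]big_ord_recr [in RHS]big_ord_recr /=.
rewrite -!/(euler_sum _ _) IHN.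
have /eqP := euler_coefS N; rewrite -eqr_oppLR => /eqP <-.
have -> : z ^+ N.+1 = Q ^+ N.+1 * (z / Q) ^+ N.+1.
  by rewrite -exprMn mulrCA divff ?mulr1 // gt_eqF.
by rewrite [(z / Q) ^+ N.+2]exprS; ring.
Qed.

Lemma norm_euler_coef_le1 i : `|euler_coef i| <= 1.
Proof.
rewrite norm_euler_coef invf_le1 ?qfact_gt0 //; elim: i => [|i IHi].
  by rewrite /qfact big_ord0.
rewrite qfactS -[leLHS]mul1r ler_pM // lerBrDr.
by apply: le_trans Q2 _; rewrite -[leLHS]expr1 ler_weXn2l.
Qed.

Lemma euler_sum_near0 N z : 0 <= z -> z <= 2^-1 ->
  `|euler_sum N z - 1| <= 2 * z.
Proof.
move=> z0 z2.
(* The slack 2 z^(N+1) pays for the next term, as z <= 1/2. *)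
suff : `|euler_sum N z - 1| <= 2 * z - 2 * z ^+ N.+1.
  by move/le_trans; apply; rewrite gerBl mulr_ge0 // exprn_ge0.
elim: N => [|N IHN].
  by rewrite /euler_sum big_ord1 euler_coef0 expr0 expr1 mulr1 !subrr normr0.
rewrite /euler_sum big_ord_recr /= -/(euler_sum N z) addrAC.
rewrite (le_trans (ler_normD _ _)) //.
have zN : 0 <= z ^+ N.+1 by rewrite exprn_ge0.
have : `|euler_coef N.+1 * z ^+ N.+1| <= z ^+ N.+1.
  by rewrite normrM (ger0_norm zN) ler_piMl // norm_euler_coef_le1.
rewrite [z ^+ N.+2]exprS.
have : z * z ^+ N.+1 <= 2^-1 * z ^+ N.+1 by rewrite ler_wpM2r.
by lra.
Qed.

Definition euler_prod (r m : nat) : R := \prod_(r.+1 <= i < m) (1 - Q ^- i).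

Let QV_le1 i : Q ^- i <= 1.
Proof. by rewrite invf_le1 // exprn_ege1. Qed.

Lemma euler_prod_ge0 r m : 0 <= euler_prod r m.
Proof. by apply: prodr_ge0 => i _; rewrite subr_ge0. Qed.

Lemma euler_prodS r m : (r < m)%N ->
  euler_prod r m.+1 = euler_prod r m * (1 - Q ^- m).
Proof. by move=> rm; rewrite /euler_prod big_nat_recr. Qed.

Lemma euler_prod_nonincreasing r : {homo euler_prod r : n m / (n <= m)%N >-> m <= n}.
Proof.
apply: homo_leq => [x //|y x z|m]; first by move=> xy yz; exact: le_trans yz xy.
have [mr|rm] := leqP m r.
  by rewrite /euler_prod !big_geq // (leq_trans mr).
by rewrite euler_prodS // ler_piMr ?euler_prod_ge0 // gerBl invr_ge0 ltW.
Qed.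

Lemma euler_prod_le1 r m : euler_prod r m <= 1.
Proof.
have := @euler_prod_nonincreasing r 0 m (leq0n m).
by rewrite {2}/euler_prod big_geq.
Qed.

Lemma is_cvg_euler_prod r : cvgn (euler_prod r).
Proof.
apply: nonincreasing_is_cvgn; first exact: euler_prod_nonincreasing.
by exists 0 => _ [m _ <-]; exact: euler_prod_ge0.
Qed.

(** Iterate the functional equation t times; the boundary terms are dominated by a geometric series
    of ratio 1/Q <= 1/2. *)
Lemma euler_sum_prod_step r N t :
  `|euler_sum N (Q ^- r) - euler_prod r (r + t).+1 * euler_sum N (Q ^- (r + t))|
  <= 2 * Q ^- N.+1 * (1 - Q ^- t).
Proof.
elim: t => [|t IHt].
  by rewrite addn0 /euler_prod big_geq // mul1r subrr normr0 expr0 invr1 subrr mulr0.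
rewrite addnS euler_prodS ?ltnS ?leq_addr //; set m := (r + t).+1 in IHt *.
move: IHt; rewrite (euler_sum_shift N (Q ^- (r + t))).
have -> : Q ^- (r + t) / Q = Q ^- m by rewrite -invfM -exprSr.
set s := euler_sum N (Q ^- m); set u := euler_prod r m.
move=> IHt.
have -> : euler_sum N (Q ^- r) - u * (1 - Q ^- m) * s =
  (euler_sum N (Q ^- r) - u * ((1 - Q ^- m) * s + euler_coef N * (Q ^- m) ^+ N.+1))
  + u * (euler_coef N * (Q ^- m) ^+ N.+1) by ring.
rewrite (le_trans (ler_normD _ _)) //.
have : `|u * (euler_coef N * (Q ^- m) ^+ N.+1)| <= Q ^- N.+1 * Q ^- t.
  rewrite [`|u * _|]normrM [`|euler_coef N * _|]normrM -[leRHS]mul1r.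
  rewrite ler_pM ?mulr_ge0 //.
    by rewrite ger0_norm ?euler_prod_ge0 ?euler_prod_le1.
  rewrite -[leRHS]mul1r ler_pM // ?norm_euler_coef_le1 //.
  rewrite exprVn -exprM gtr0_norm ?invr_gt0 // -invfM -exprD.
  rewrite lef_pV2 ?posrE // ler_weXn2l // /m; nia.
have : Q ^- N.+1 * Q ^- t <= 2 * Q ^- N.+1 * Q ^- t - 2 * Q ^- N.+1 * Q ^- t.+1.
  rewrite -[2 * _ * Q ^- t]mulrA -[2 * _ * Q ^- t.+1]mulrA.
  rewrite [Q ^+ t.+1]exprS invfM.
  set w := Q ^- N.+1 * Q ^- t.
  have w0 : 0 <= w by rewrite mulr_ge0 // invr_ge0 ltW.
  have -> : Q ^- N.+1 * (Q^-1 * Q ^- t) = Q^-1 * w by rewrite /w; ring.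
  have : Q^-1 * w <= 2^-1 * w by rewrite ler_wpM2r // lef_pV2 ?posrE.
  by lra.
by move: IHt; rewrite !mulrBr !mulr1; lra.
Qed.

(** For m >= n > 0 the truncated series at Q^(-m) is within 2 Q^(-m) of 1, so the value at Q^(-r) is
    close to the partial product. Boundary terms and this tail each cost 2 Q^r / Q^n; then m tends
    to infinity. *)
Lemma euler_sum_lim r n : (r <= n)%N -> (0 < n)%N ->
  `|euler_sum (n - r) (Q ^- r) - limn (euler_prod r)| <= 4 * Q ^+ r / Q ^+ n.
Proof.
move=> rn n0; set s := euler_sum _ _.
have close m : (n < m)%N -> `|s - euler_prod r m| <= 4 * Q ^+ r / Q ^+ n.
  case: m => // m nm.
  have := euler_sum_prod_step r (n - r) (m - r).
  rewrite subnKC ?(leq_trans rn) // -/s; set u := euler_prod r m.+1.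
  set v := euler_sum _ (Q ^- m) => h1.
  have h2 : `|v - 1| <= 2 * Q ^- m.
    apply: euler_sum_near0; first by rewrite invr_ge0 ltW.
    rewrite lef_pV2 ?posrE // (le_trans Q2) // -[leLHS]expr1 ler_weXn2l //.
    exact: leq_trans n0 nm.
  have -> : s - u = (s - u * v) + u * (v - 1) by ring.
  rewrite (le_trans (ler_normD _ _)) //.
  have h3 : `|u * (v - 1)| <= 2 * Q ^- m.
    by rewrite normrM -[leRHS]mul1r ler_pM // ger0_norm ?euler_prod_ge0 ?euler_prod_le1.
  have h4 : Q ^- m <= Q ^+ r / Q ^+ n.
    rewrite (_ : _ / _ = (Q ^+ (n - r))^-1); last first.
      by rewrite -{1}(subnK rn) exprD; field; rewrite !gt_eqF.
    rewrite lef_pV2 ?posrE // ler_weXn2l //; lia.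
  have h5 : Q ^- (n - r).+1 <= Q ^+ r / Q ^+ n.
    rewrite (_ : _ / _ = (Q ^+ (n - r))^-1); last first.
      by rewrite -{1}(subnK rn) exprD; field; rewrite !gt_eqF.
    by rewrite lef_pV2 ?posrE // ler_weXn2l.
  have h6 : 2 * Q ^- (n - r).+1 * (1 - Q ^- (m - r)) <= 2 * Q ^- (n - r).+1.
    rewrite ler_piMr ?mulr_ge0 ?invr_ge0 ?(ltW (QX0 _)) //.
    by rewrite gerBl invr_ge0 ltW.
  by lra.
have cv := @is_cvg_euler_prod r.
rewrite ler_distlC; apply/andP; split.
  by apply: limr_ge => //; exists n.+1 => // m /close; rewrite ler_distlC => /andP[].
by apply: limr_le => //; exists n.+1 => // m /close; rewrite ler_distlC => /andP[].
Qed.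

End QSeries.

(** * From moments to the probability *)

Lemma natr_prod_expB (R : realType) (q d k : nat) : (0 < q)%N ->
  (\prod_(i < k) (q ^ d - q ^ i))%N%:R
  = \prod_(i < k) (q%:R ^+ d - q%:R ^+ i) :> R.
Proof.
move=> q0; rewrite natr_prod; have [dk|kd] := ltnP d k.
  (* Truncation could only occur here, where the factor at i = d makes both products 0. *)
  rewrite (bigD1 (Ordinal dk)) //= [RHS](bigD1 (Ordinal dk)) //=.
  by rewrite subnn subrr !mul0r.
apply: eq_bigr => i _; rewrite natrB ?natrX //.
by rewrite leq_pexp2l // (leq_trans (ltnW (ltn_ord i)) kd).
Qed.

Lemma dim_kerE (F : fieldType) (n : nat) (M : 'M[F]_n) :
  dim_ker M = \rank (kermx M).
Proof. by rewrite /dim_ker !mxrank_ker mxrank_tr. Qed.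

(** Apply [q_moment_inversion] to the kernel dimension of each M, then average over M and exchange
    sums. *)
Lemma prob_dim_kerE (R : realType) (F : finFieldType) (n r : nat) (C : 'M[F]_n) :
  alternating_mx C -> (r <= n)%N ->
  uniform_prob R (C_symmetric_set C) [set M : 'M[F]_n | dim_ker M == r]%SET
    * (Defs.card_GL F r)%:R
  = \sum_(i < (n - r).+1) euler_coef #|F|%:R i / #|F|%:R ^+ (r * i)
                           * moment C R (r + i).
Proof.
move=> altC rn; set A := C_symmetric_set C; set Q : R := #|F|%:R.
have q0 : (0 < #|F|)%N by exact: ltnW (card_finNzRing_gt1 F).
have -> : uniform_prob R A [set M : 'M[F]_n | dim_ker M == r]%SET
    * (Defs.card_GL F r)%:R
  = (\sum_(M in A) (dim_ker M == r)%:R * (Defs.card_GL F r)%:R) / #|A|%:R.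
  rewrite /uniform_prob -big_distrl /= mulrAC -natr_sum; congr (_%:R * _ / _).
  rewrite -sum1_card big_mkcond [RHS]big_mkcond; apply: eq_bigr => M _.
  have EM : (M \in [set M : 'M[F]_n | dim_ker M == r]%SET) = (dim_ker M == r).
    by rewrite inE.
  rewrite in_setI EM.
  by case: (M \in A); case: (dim_ker M == r).
have ker_le (M : 'M[F]_n) : (\rank (kermx M) <= n)%N by exact: rank_leq_row.
transitivity ((\sum_(M in A) \sum_(i < (n - r).+1) euler_coef Q i / Q ^+ (r * i)
    * #|free_rows_in_ker (r + i) M|%:R) / #|A|%:R).
  congr (_ / _); apply: eq_bigr => M _.
  rewrite card_GL_prod natr_prod_expB // dim_kerE.
  rewrite -(q_moment_inversion (card_field_ge2 F R) (ker_le M) rn).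
  by apply: eq_bigr => i _; rewrite card_free_rows_in_ker natr_prod_expB.
rewrite exchange_big big_distrl /=; apply: eq_bigr => i _.
rewrite momentE //; last by have := ltn_ord i; lia.
by rewrite -big_distrr /= natr_sum mulrA.
Qed.

(** The exponent of [moment_close] splits so that Q^(r i) cancels and Q^(i(i+1)/2) is absorbed by
    [qfact_ge], leaving a bound uniform in i. *)
Lemma moment_term_le (R : realType) (F : finFieldType) (n r i : nat)
    (C : 'M[F]_n) :
  alternating_mx C -> (r + i <= n)%N ->
  `|euler_coef #|F|%:R i / #|F|%:R ^+ (r * i) * (moment C R (r + i) - 1)|
  <= 4 * #|F|%:R ^+ 'C(r.+1, 2) / #|F|%:R ^+ \rank C.
Proof.
move=> altC rin; have Q2 := card_field_ge2 F R.
have := moment_close altC R rin; move: (moment _ _ _) => m.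
have -> : 'C((r + i).+1, 2) = ('C(r.+1, 2) + 'C(i.+1, 2) + r * i)%N.
  elim: (r) => [|j IHj]; first by rewrite (@bin_small 1 2) // mul0n addn0.
  by rewrite addSn [LHS]binS bin1 IHj ['C(j.+2, 2)]binS bin1; lia.
move: (#|F|%:R : R) Q2 => Q Q2; rewrite 2!exprD => m_close.
have QX j : 0 < Q ^+ j by apply: exprn_gt0; exact: lt_le_trans Q2.
have qf0 := qfact_gt0 Q2 i.
rewrite normrM [`|euler_coef Q i / _|]normrM norm_euler_coef //.
rewrite (gtr0_norm (_ : 0 < (Q ^+ (r * i))^-1)) ?invr_gt0 //.
apply: le_trans (ler_wpM2l _ m_close) _.
  by rewrite mulr_ge0 ?invr_ge0 ?(ltW qf0) ?(ltW (QX _)).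
rewrite [leLHS](_ : _ =
  Q ^+ 'C(i.+1, 2) / qfact Q i * (Q ^+ 'C(r.+1, 2) / Q ^+ \rank C)).
  rewrite -[leRHS]mulrA ler_pM2r ?divr_gt0 // ler_pdivrMr //.
  exact: qfact_ge.
by field; rewrite !gt_eqF.
Qed.

Theorem corollary3p14 (R : realType) (l r : nat) (hl : prime_power l) :
  exists (K : R) (n0 c0 : nat),
    forall (F : finFieldType), #|F| = l ->
    forall n c : nat, (n0 <= n)%N -> (c0 <= c)%N -> ~~ odd c ->
    forall C : 'M[F]_n, alternating_mx C -> \rank C = c ->
      `|uniform_prob R (C_symmetric_set C) [set M : 'M[F]_n | dim_ker M == r]%SET
        - mu_CL R F r|
      <= K * (n%:R * l%:R ^- c).
Proof.
pose Q : R := l%:R.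
(* At most n - r + 1 <= 2n moment terms cost 4 Q^(r(r+1)/2) each, hence 8; 4 Q^r comes from
   [euler_sum_lim]. The threshold gives r <= n and n > 0. *)
exists (8 * Q ^+ 'C(r.+1, 2) + 4 * Q ^+ r), r.+1, 0%N.
move=> F Fl n c rn _ _ C altC rC.
have n0 : (0 < n)%N by exact: leq_trans rn.
have {}rn : (r <= n)%N by exact: ltnW.
rewrite -rC /Q -Fl {rC c Q hl Fl l}; set Q : R := #|F|%:R.
have Q2 : 2 <= Q := card_field_ge2 F R.
have Q0 : 0 < Q by exact: lt_le_trans Q2.
have QX j : 0 < Q ^+ j by exact: exprn_gt0.
have G1 : 1 <= (Defs.card_GL F r)%:R :> R.
  rewrite ler1n card_GL_prod; apply: prodn_gt0 => i.
  by rewrite subn_gt0 ltn_exp2l ?card_finNzRing_gt1.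
have G0 : 0 < (Defs.card_GL F r)%:R :> R by exact: lt_le_trans G1.
set G := (Defs.card_GL F r)%:R in G0 G1; set P := uniform_prob _ _ _.
set L := limn (euler_prod Q r).
have PG := prob_dim_kerE R altC rn; rewrite -/P -/G -/Q in PG.
rewrite /mu_CL -/G -/Q -[limn _]/L.
(* Dividing by G >= 1 only shrinks the error. *)
suff PL : `|P * G - L| <=
    (8 * Q ^+ 'C(r.+1, 2) + 4 * Q ^+ r) * (n%:R * Q ^- \rank C).
  have -> : P - G^-1 * L = (P * G - L) * G^-1 by field; rewrite gt_eqF.
  rewrite normrM (gtr0_norm (_ : 0 < G^-1)) ?invr_gt0 //.
  by apply: le_trans PL; rewrite ler_piMr // invf_le1.
(* Replacing each moment by 1 turns the sum into [euler_sum] at Q^(-r). *)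
have -> : P * G - L =
    \sum_(i < (n - r).+1) euler_coef Q i / Q ^+ (r * i) * (moment C R (r + i) - 1)
    + (euler_sum Q (n - r) (Q ^- r) - L).
  rewrite PG addrA; congr (_ - _); rewrite -big_split /=; apply: eq_bigr => i _.
  by rewrite exprVn -exprM; ring.
apply: le_trans (ler_normD _ _) _; rewrite mulrDl; apply: lerD.
  apply: le_trans (ler_norm_sum _ _ _) _.
  apply: le_trans (_ : \sum_(i < (n - r).+1) 4 * Q ^+ 'C(r.+1, 2) / Q ^+ \rank C <= _).
    by apply: ler_sum => i _; apply: moment_term_le => //; have := ltn_ord i; lia.
  have hn : (n - r).+1%:R <= 2 * n%:R :> R by rewrite -natrM ler_nat; lia.
  pose w := 4 * Q ^+ 'C(r.+1, 2) / Q ^+ \rank C; rewrite -/w.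
  rewrite sumr_const card_ord -(mulr_natl w).
  have w0 : 0 <= w by rewrite ltW // divr_gt0 // mulr_gt0.
  apply: le_trans (ler_wpM2r w0 hn) _.
  by rewrite le_eqVlt; apply/orP; left; apply/eqP; rewrite /w; ring.
apply: le_trans (euler_sum_lim Q2 rn n0) _.
rewrite ler_pM2l ?mulr_gt0 // -[leLHS]mul1r ler_pM ?invr_ge0 ?(ltW (QX _)) //.
  by rewrite ler1n.
rewrite lef_pV2 ?posrE // ler_weXn2l ?rank_leq_col //.
by apply: le_trans Q2; rewrite ler1n.
Qed.
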